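(* Let $p$ be an odd prime. Then every group in the variety of groups of exponent $p$ and nilpotency class at most $2$ has an integral.
   Context: For a group $H$, $H'$ denotes the derived group (commutator subgroup). An integral of a group $G$ is a group $H$ such that $H'\cong G$. The variety in question is $\mathbf{B}_p\cap\mathbf{N}_2$, where $\mathbf{B}_p$ is the variety of groups of exponent $p$ (defined by the identity $x^p=1$) and $\mathbf{N}_2$ is the variety of nilpotent groups of class at most $2$. Groups may be infinite. *)

(* Defs.v *)
From HB Require Import structures.
From mathcomp Require Import all_boot.
From mathcomp Require Import boolp classical_sets.

Set Implicit Arguments.
Unset Strict Implicit.
Unset Printing Implicit Defensive.

Local Open Scope classical_set_scope.
Local Open Scope group_scope.

(* Possibly infinite groups are [groupType]s. The choiceType structure that a
   [groupType] carries is no restriction on the group, since boolp provides one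
   on every type. *)

Section Subgroups.
Variable G : groupType.
Implicit Types A B : set G.

Definition is_subgroup A : Prop :=
  [/\ A 1, (forall x y, A x -> A y -> A (x * y)) & (forall x, A x -> A x^-1)].

Definition generated A : set G := smallest is_subgroup A.

Definition commutator_subgroup A B : set G :=
  generated [set [~ x, y] | x in A & y in B].

(* Indexed from 0: [lower_central n] is the term usually written
   gamma_{n+1}(G). *)
Fixpoint lower_central (n : nat) : set G :=
  if n is m.+1 then commutator_subgroup (lower_central m) setT else setT.

Definition nilpotent_class_le (c : nat) : Prop :=
  lower_central c = [set 1].

Definition derived_set : set G := commutator_subgroup setT setT.

Definition derived_pred : {pred G} := fun x => `[< derived_set x >].

Lemma generated_subgroup A : is_subgroup (generated A).
Proof.
split=> [B [[]] //|x y Ax Ay B BA|x Ax B BA].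
  by case: (BA) => -[_ BM _] _; apply: BM; [apply: Ax | apply: Ay].
by case: (BA) => -[_ _ BV] _; apply: BV; apply: Ax.
Qed.

Lemma derived_group_closed : group_closed derived_pred.
Proof.
have [D1 DM DV] := generated_subgroup [set [~ x, y] | x in setT & y in setT].
split; first exact/asboolP.
by move=> x y /asboolP Dx /asboolP Dy; apply/asboolP; apply: DM Dx (DV _ Dy).
Qed.

End Subgroups.

Arguments derived_set G : clear implicits.
Arguments derived_pred G : clear implicits.

Record derived (G : groupType) := Derived {
  derived_val :> G;
  _ : derived_val \in derived_pred G
}.

HB.instance Definition _ (G : groupType) := [isSub for @derived_val G].
HB.instance Definition _ (G : groupType) := [Choice of derived G by <:].
HB.instance Definition _ (G : groupType) :=
  SubChoice_isSubGroup.Build G (derived_pred G) (derived G)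
    (@derived_group_closed G).

Definition isomorphic (G H : groupType) : Prop :=
  exists f : {multiplicative G -> H}, bijective f.

Definition is_integral (G H : groupType) : Prop := isomorphic (derived H) G.

Definition has_integral (G : groupType) : Prop :=
  exists H : groupType, is_integral G H.

Definition in_Bp (p : nat) (G : groupType) : Prop := forall x : G, x ^+ p = 1.

Definition in_Nc (c : nat) (G : groupType) : Prop := nilpotent_class_le G c.

(* Main.v *)
Require Import Defs.
From mathcomp Require Import all_boot.
From HB Require Import structures.
From mathcomp Require Import boolp classical_sets.

(** An automorphism s of G with s^2 = 1 and x * s x in G' for all x inverts the
    abelian group G / G'. In the extension H of G by <s>, of order 2, the
    commutator of x and s is x^-1 * s x, which is x^-2 modulo G'; since G has
    odd exponent, the squares fill G / G', so H', which also contains G',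
    contains G. It is no larger, because H / G has order 2. Hence H is an
    integral of G ([is_integral_extension]), and all that is needed is the
    automorphism s ([exists_inverting_automorphism]).

    One builds s by Zorn's lemma from partial automorphisms, each encoded by its
    graph in G x G: involutive, inverting modulo G', and stable under
    multiplication by the diagonal elements (z, z) with z in G'. To extend
    one to a further element x, send x to x^-1. The point is that this respects
    the commutation relations: if c is sent to d, then d = c^-1 modulo the
    centre, so in class 2
      [x^-1, d] = [x^-1, c^-1] = [x, c],
    which is the image of [x, c] as s fixes G' pointwise ([commg_inverting]).
    Since x has prime order, a power of x lying in the old domain is trivial
    unless x itself lies there, so the extension is still single-valued
    ([pinv_adjoin]). *)

Set Implicit Arguments.
Unset Strict Implicit.
Unset Printing Implicit Defensive.

Local Open Scope classical_set_scope.
Local Open Scope group_scope.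

(** * Extension of a group by an involutive automorphism *)

Section InvolutiveExtension.
Variables (G : groupType) (s : UMagmaMorphism.type G G).

Definition twist (b : bool) (x : G) : G := if b then s x else x.

(** The proof of involutivity is a parameter of the type, for the group
    structure depends on it. *)
Definition involutive_extension of involutive s : Type := (G * bool)%type.

Hypothesis sK : involutive s.
Notation H := (involutive_extension sK).

HB.instance Definition _ := Choice.on H.

Definition ext_one : H := (1, false).
Definition ext_inv (u : H) : H := (twist u.2 u.1^-1, u.2).
Definition ext_mul (u v : H) : H := (u.1 * twist u.2 v.1, u.2 (+) v.2).

Fact ext_mulA : associative ext_mul.
Proof.
move=> [x a] [y b] [z c]; rewrite /ext_mul /= addbA.
by case: a b => [] [] /=; rewrite ?gmulfM ?sK mulgA.
Qed.

Fact ext_mul1 : left_id ext_one ext_mul.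
Proof. by move=> [x a]; rewrite /ext_mul /= mul1g. Qed.

Fact ext_mulr1 : right_id ext_one ext_mul.
Proof.
by move=> [x a]; rewrite /ext_mul /= addbF; case: a; rewrite /= ?gmulf1 mulg1.
Qed.

Fact ext_mulV : left_inverse ext_one ext_inv ext_mul.
Proof.
move=> [x a]; rewrite /ext_mul /= addbb /ext_one; case: a => /=.
  by rewrite -gmulfM mulVg gmulf1.
by rewrite mulVg.
Qed.

Fact ext_mulrV : right_inverse ext_one ext_inv ext_mul.
Proof.
by move=> [x a]; rewrite /ext_mul /= addbb; case: a; rewrite /= ?sK mulgV.
Qed.

HB.instance Definition _ :=
  isGroup.Build H ext_mulA ext_mul1 ext_mulr1 ext_mulV ext_mulrV.

Definition ext_in (x : G) : H := (x, false).

Fact ext_in_mul : {morph ext_in : x y / x * y}.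
Proof. by []. Qed.
HB.instance Definition _ :=
  isUMagmaMorphism.Build G H ext_in (erefl, ext_in_mul).

Lemma derived_extension_fst (u : H) : derived_set H u -> u.2 = false.
Proof.
move=> /(_ [set v | v.2 = false]); apply; split=> [|_ [v _ [w _ <-]]].
  by split=> // -[x a] [y b] /= -> ->.
by case: v w => [? []] [? []].
Qed.

Lemma derived_extension_in (x : G) :
    generated ([set x^-1 * s x | x in setT] `|` derived_set G) = setT ->
  derived_set H (ext_in x).
Proof.
move=> genG; have [D1 DM DV] :=
  generated_subgroup [set [~ u, v] | u in [set: H] & v in [set: H]].
have preD : is_subgroup [set y | derived_set H (ext_in y)].
  split=> [|y z Dy Dz|y Dy] /=; first by rewrite gmulf1.
    by rewrite gmulfM; apply: DM.
  by rewrite gmulfV; apply: DV.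
have: [set: G] x by [].
rewrite -genG; apply: (smallest_sub preD) => y [[z _ <-]|].
  (* z^-1 * s z is the commutator of z with the involution (1, true) *)
  apply: sub_gen_smallest.
  exists (ext_in z) => //; exists ((1, true) : H) => //.
  rewrite /commg /conjg /ext_in; congr pair.
  by rewrite /= !gmulfM gmulfV !gmulf1 !mulg1 invg1 mul1g.
apply: (smallest_sub preD) => _ [u _ [v _ <-]] /=; rewrite gmulfR.
by apply: sub_gen_smallest; exists (ext_in u) => //; exists (ext_in v).
Qed.

(** The derived group of the extension lies in G since the quotient by G has
    order 2. Conversely it contains G' and the commutators x^-1 * s x of the
    elements of G with s, and these generate G by hypothesis. *)
Lemma is_integral_extension :
    generated ([set x^-1 * s x | x in setT] `|` derived_set G) = setT ->
  is_integral G H.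
Proof.
move=> genG; pose f (u : derived H) : G := (val u : H).1.
have valN (u : derived H) : (val u : H).2 = false.
  by apply: derived_extension_fst; apply/asboolP; exact: (valP u).
have fM : {morph f : u v / u * v}.
  by move=> u v; rewrite /f valM /= /ext_mul /= valN.
pose F := isMultiplicative.Build (derived H) G f fM.
pose fm : {multiplicative derived H -> G} := HB.pack f F.
have Din x : ext_in x \in derived_pred H.
  by apply/asboolP; exact: derived_extension_in.
exists fm; exists (fun x => Derived (Din x)) => [u|x] //.
have ext_in_fst (v : H) : v.2 = false -> ext_in v.1 = v.
  by case: v => y b /= ->.
by apply: val_inj; apply: ext_in_fst.
Qed.

End InvolutiveExtension.

(** * Central commutators *)

Section ClassTwo.
Variable G : groupType.
Hypothesis G_N2 : in_Nc 2 G.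
Notation D := (derived_set G).

Lemma derived_central (z x : G) : D z -> commute z x.
Proof.
move=> Dz; apply/commgP/eqP; have: @lower_central G 2 [~ z, x].
  by apply: sub_gen_smallest; exists z => //; exists x.
by rewrite G_N2.
Qed.

Lemma derived_is_subgroup : is_subgroup D.
Proof. exact: generated_subgroup. Qed.

Lemma derived1 : D 1.
Proof. by case: derived_is_subgroup. Qed.

Lemma derivedM (x y : G) : D x -> D y -> D (x * y).
Proof. by case: derived_is_subgroup => _ + _; apply. Qed.

Lemma derived_commg (x y : G) : D [~ x, y].
Proof. by apply: sub_gen_smallest; exists x => //; exists y. Qed.

(** Both [x^-1, y^-1] and [x, y] carry y * x to x * y, one multiplying on the
    left and the other on the right. *)
Lemma commgVV (x y : G) : [~ x^-1, y^-1] = [~ x, y].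
Proof.
apply: (mulIg (y * x)); rewrite -commgCV.
by rewrite (derived_central (y * x) (derived_commg x y)) -commgC.
Qed.

(** The commutators that rule the conjugation by u and by u^-1 agree on elements
    that a partial inversion matches; this is what allows u to be sent to
    u^-1. *)
Lemma commg_inverting (u c d : G) : D (c * d) -> [~ u^-1, d] = [~ u, c].
Proof.
move=> Dcd; rewrite -(mulKg c d) -(commgVV u c) !commgEl conjgM; congr (_ * _).
by apply/conjg_fixP/commgP/commute_sym/derived_central.
Qed.

Lemma mulg_exchange (a u c v : G) :
  a * u * (c * v) = a * c * [~ u, c] * (u * v).
Proof.
have wC x : [~ u, c] * x = x * [~ u, c].
  by apply: derived_central; apply: derived_commg.
move: [~ u, c] wC (commgC u c) => w wC uc.
by rewrite !mulgA -(mulgA a u) uc -wC -(mulgA a c) -wC !mulgA.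
Qed.

End ClassTwo.

(** * Partial inversions *)

Section Inversion.
Variables (G : groupType) (p : nat).
Hypotheses (p_prime : prime p) (G_Bp : in_Bp p G) (G_N2 : in_Nc 2 G).
Notation D := (derived_set G).

(** Every clause is an implication from membership in A, so that the empty graph
    satisfies them: the union of an empty chain then needs no special case in
    Zorn's lemma. Closure under inverses is [pinvV], inverses being powers. *)
Record partial_inversion (A : set (G * G)) : Prop := PartialInversion {
  pinvM : forall a b c d, A (a, b) -> A (c, d) -> A (a * c, b * d);
  pinv_sym : forall a b, A (a, b) -> A (b, a);
  pinvD : forall a b, A (a, b) -> D (a * b);
  pinv1 : forall b, A (1, b) -> b = 1;
  pinv_shift : forall a b z, A (a, b) -> D z -> A (a * z, b * z)
}.

Lemma expg_predV (x : G) : x ^+ p.-1 = x^-1.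
Proof.
by apply/(mulgI x); rewrite -expgS prednK ?prime_gt0 // G_Bp mulgV.
Qed.

Lemma pinvX A a b n : partial_inversion A ->
  A (a, b) -> A (a ^+ n.+1, b ^+ n.+1).
Proof.
move=> PA Aab; elim: n => [|n IHn]; first by rewrite !expg1.
by rewrite [a ^+ _]expgS [b ^+ _]expgS; apply: pinvM.
Qed.

Lemma pinvV A a b : partial_inversion A -> A (a, b) -> A (a^-1, b^-1).
Proof.
move=> PA Aab; rewrite -!expg_predV.
by have: 1 < p := prime_gt1 p_prime; case: p => [|[|n]] // _; apply: pinvX.
Qed.

Lemma pinv11 A a b : partial_inversion A -> A (a, b) -> A (1, 1).
Proof.
move=> PA Aab; rewrite -{1}(mulgV a) -(mulgV b).
by apply: pinvM (pinvV _ _).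
Qed.

Lemma pinv_fun A a b b' : partial_inversion A ->
  A (a, b) -> A (a, b') -> b = b'.
Proof.
move=> PA Aab Aab'; apply/esym/divg1_eq/(pinv1 PA).
by rewrite -(mulgV a); apply: pinvM (pinvV _ _).
Qed.

Lemma pinv_bigcup (F : set (set (G * G))) :
    F `<=` partial_inversion -> total_on F subset ->
  partial_inversion (\bigcup_(X in F) X).
Proof.
move=> PF totF; split.
- move=> a b c d [X FX Xab] [Y FY Ycd]; have [XY|YX] := totF _ _ FX FY.
    by exists Y => //; apply: pinvM (PF _ FY) _ _ _ _ (XY _ Xab) Ycd.
  by exists X => //; apply: pinvM (PF _ FX) _ _ _ _ Xab (YX _ Ycd).
- by move=> a b [X FX Xab]; exists X => //; apply: pinv_sym (PF _ FX) _ _ Xab.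
- by move=> a b [X FX Xab]; apply: pinvD (PF _ FX) _ _ Xab.
- by move=> b [X FX Xb]; apply: pinv1 (PF _ FX) _ Xb.
- move=> a b z [X FX Xab] Dz; exists X => //.
  exact: pinv_shift (PF _ FX) _ _ _ Xab Dz.
Qed.

(** The nonempty partial inversion that rules out the empty graph as a maximal
    one. *)
Lemma pinv_diagonal : partial_inversion [set u | u.1 = u.2 /\ D u.1].
Proof.
split=> /=.
- by move=> a b c d [<- Da] [<- Dc]; split=> //; apply: derivedM.
- by move=> a b [<- Da].
- by move=> a b [<- Da]; apply: derivedM.
- by move=> b [].
- by move=> a b z [<- Da] Dz; split=> //; apply: derivedM.
Qed.

Definition adjoin (A : set (G * G)) (x : G) : set (G * G) :=
  [set u | exists a b i, A (a, b) /\ u = (a * x ^+ i, b * x ^- i)].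

(** If x ^+ i is nontrivial, then i is invertible modulo p, and k is its
    inverse. *)
Lemma expg_generates (x : G) i : x ^+ i != 1 -> exists k, x = (x ^+ i) ^+ k.
Proof.
move=> xi1; have pi : coprime p i.
  rewrite prime_coprime //; apply: contra xi1 => /dvdnP[k ->].
  by rewrite mulnC expgnA G_Bp expg1n.
have [k [m km]] : exists k m, (i * k = m * p + 1)%N.
  have [i0|i_gt0] := posnP i; first by rewrite i0 expg0 eqxx in xi1.
  have [k m + _] := egcdnP p i_gt0; rewrite gcdnC (eqP pi) => km.
  by exists k, m; rewrite mulnC.
by exists k; rewrite -expgnA km expgnDr mulnC expgnA G_Bp expg1n mul1g expg1.
Qed.

(** Stability under products is [commg_inverting]: collecting the powers of x to
    the right creates the same central commutator in both coordinates, and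
    [pinv_shift] absorbs it. Single-valuedness is [expg_generates]. *)
Lemma pinv_adjoin A x : partial_inversion A ->
  (forall y, ~ A (x, y)) -> partial_inversion (adjoin A x).
Proof.
move=> PA xA; split.
- move=> _ _ _ _ [a [b [i [Aab [-> ->]]]]] [c [d [j [Acd [-> ->]]]]].
  exists (a * c * [~ x ^+ i, c]), (b * d * [~ x ^+ i, c]), (i + j)%N; split.
    by apply: (pinv_shift PA); [apply: pinvM | apply: derived_commg].
  (* the same factor [~ x ^+ i, c] arises from a, c and from b, d *)
  have -> : x ^- (i + j) = x ^- i * x ^- j by rewrite addnC expgnDr invgM.
  rewrite (mulg_exchange G_N2 b) (commg_inverting G_N2 _ (pinvD PA Acd)).
  by rewrite (mulg_exchange G_N2 a) -expgnDr.
- move=> _ _ [a [b [i [Aab [-> ->]]]]]; exists b, a, (i * p.-1)%N.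
  split; first exact: pinv_sym.
  by rewrite mulnC expgnA expg_predV expVgn invgK.
- move=> _ _ [a [b [i [Aab [-> ->]]]]].
  have -> : a * x ^+ i * (b * x ^- i) = a * b * [~ b, x ^- i].
    by rewrite /commg /conjg !invgK !mulgA mulgK.
  by apply: derivedM (pinvD PA Aab) (derived_commg _ _).
- move=> _ [a [b [i [Aab [/esym axi1 ->]]]]].
  have def_a : a = x ^- i by apply/eqP; rewrite -mulg_eq1; apply/eqP.
  have [xi1|xi1] := eqVneq (x ^+ i) 1.
    rewrite xi1 invg1 mulg1; apply: (pinv1 PA).
    by rewrite def_a xi1 invg1 in Aab.
  have [k def_x] := expg_generates xi1.
  (* x is a power of x ^+ i = a^-1, so x lies in the domain of A *)
  case: k def_x => [|k] def_x.
    by move: xi1; rewrite def_x expg0 expg1n eqxx.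
  case: (xA (b ^- k.+1)); rewrite {1}def_x -[x ^+ i]invgK -def_a expVgn.
  by apply: pinvV => //; apply: pinvX.
- move=> _ _ z [a [b [i [Aab [-> ->]]]]] Dz.
  exists (a * z), (b * z), i; split; first exact: pinv_shift.
  by rewrite -!mulgA !(derived_central G_N2 _ Dz).
Qed.

(** A maximal partial inversion is total by [pinv_adjoin], and a total one is
    the graph of an automorphism. *)
Lemma exists_inverting_automorphism : exists s : UMagmaMorphism.type G G,
  involutive s /\ forall x, D (x * s x).
Proof.
have [A [PA maxA]] := Zorn_bigcup pinv_bigcup.
have [[a b] Aab] : A !=set0.
  have [//|/set0P/negP/negPn/eqP A0] := pselect (A !=set0).
  case: (maxA _ _ pinv_diagonal); rewrite A0; split; first by [].
  by move/(_ (1, 1)); apply; split=> //; apply: derived1.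
have A11 := pinv11 PA Aab.
have totA x : exists y, A (x, y).
  apply: contrapT => /forallNP xA; apply: (maxA _ _ (pinv_adjoin PA xA)).
  split=> [[c d] Acd|BA].
    by exists c, d, 0%N; rewrite !expg0 invg1 !mulg1.
  apply: (xA x^-1); apply: BA; exists 1, 1, 1%N.
  by rewrite expg1 !mul1g.
have [s As] := choice totA.
have sM : {morph s : x y / x * y}.
  by move=> x y; apply: (pinv_fun PA (As _)); apply: pinvM.
have s1 : s 1 = 1 by apply: (pinv1 PA).
pose S := isUMagmaMorphism.Build G G s (s1, sM).
exists (HB.pack_for (UMagmaMorphism.type G G) s S); split=> x /=.
  by apply: (pinv_fun PA (As _)); apply: pinv_sym.
exact: pinvD (As x).
Qed.

End Inversion.

Theorem theorem6p8 (p : nat) (p_prime : prime p) (p_odd : odd p)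
    (G : groupType) (G_Bp : in_Bp p G) (G_N2 : in_Nc 2 G) :
  has_integral G.
Proof.
have [s [sK sD]] := exists_inverting_automorphism p_prime G_Bp G_N2.
exists (involutive_extension sK); apply: is_integral_extension.
apply/seteqP; split=> // x _; set S := _ `|` _.
have [_ SM SV] := generated_subgroup S.
have S_sub := @sub_gen_smallest _ (@is_subgroup G) S.
have sqS : generated S (x * x).
  (* x^2 is the quotient of x * s x, in G', by the commutator x^-1 * s x *)
  have -> : x * x = (x * s x) * (x^-1 * s x)^-1.
    by rewrite invgM invgK !mulgA mulgK.
  by apply: SM; [apply: S_sub; right | apply: SV; apply: S_sub; left; exists x].
(* as p is odd, p.+1./2 is an inverse of 2 modulo the exponent *)
have -> : x = (x * x) ^+ p.+1./2.
  by rewrite -expg2 -expgnA mul2n halfK /= p_odd subn0 expgS G_Bp mulg1.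
elim: p.+1./2 => [|n IHn]; first by case: (generated_subgroup S).
by rewrite expgS; apply: SM.
Qed.
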